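(* Let $p$ be a prime and $m\ge 1$ an integer such that $3\mid p^m-1$. Let $\beta\in\mathbb F_{p^m}$ with $\beta\ne 0$ and let $i,j\in\{0,1,2\}$. Then the number $R_{p^m}^{(3)}(\beta,i,j)$ of representations of $\beta$ as the sum of an element of $\mathcal A_j$ and an element of $\mathcal A_i$ is $$R_{p^m}^{(3)}(\beta,i,j)=\frac19\left(p^m-2-K-\bar K\right),$$ where $$K=\chi_3(\beta)(\omega^{2i}+\omega^{2j})+\omega^{2i+j}-\omega^{2i+2j}\,\bar\chi_3(\beta)\,J(\chi_3,\chi_3),$$ and, for fixed $p^m,i,j$, it depends only on the cubic residuacity of $\beta$ (that is, only on the value $\chi_3(\beta)$).
   Context: $\mathbb F_{p^m}$ is the finite field with $p^m$ elements, $\alpha$ is a fixed primitive element (generator of $\mathbb F_{p^m}^*$), and $\omega\in\mathbb C$ is a fixed primitive cube root of unity. $\mathcal A_0$ is the subgroup of nonzero cubes in $\mathbb F_{p^m}^*$, $\mathcal A_1=\alpha\mathcal A_0$ and $\mathcal A_2=\alpha^2\mathcal A_0$. $\chi_3$ is the cubic character given by $\chi_3(\alpha^h\theta)=\omega^h$ for $\theta\in\mathcal A_0$, $h=0,1,2$, and $\chi_3(0)=0$. The bar denotes complex conjugation, and $\bar\chi_3(x)=\overline{\chi_3(x)}$. $J(\chi_3,\chi_3)=\sum_{c_1,c_2\in\mathbb F_{p^m},\,c_1+c_2=1}\chi_3(c_1)\chi_3(c_2)$ is the Jacobi sum. Representations are ordered: $R_{p^m}^{(3)}(\beta,i,j)$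 is the number of pairs $(z,w)\in\mathcal A_j\times\mathcal A_i$ with $z+w=\beta$ ($i=j$ is allowed). *)

(* Defs.v *)
From HB Require Import structures.
From mathcomp Require Import all_boot all_order all_algebra all_fingroup all_solvable all_field.

Set Implicit Arguments.
Unset Strict Implicit.
Unset Printing Implicit Defensive.

Import Order.TTheory GRing.Theory Num.Theory.

Local Open Scope ring_scope.

Definition nonzero_cubes (F : finFieldType) : {set F} :=
  [set x : F | (x != 0) && [exists y : F, x == y ^+ 3]].

Definition cubic_coset (F : finFieldType) (alpha : {unit F}) (h : 'I_3) : {set F} :=
  [set FinRing.uval alpha ^+ h * theta | theta in nonzero_cubes F].

(* The cosets are pairwise disjoint when alpha generates the unit group and
   3 divides #|F| - 1, so the choice made by [pick] is then forced; 0 lies in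
   no coset and is sent to 0. *)
Definition cubic_char (F : finFieldType) (C : numClosedFieldType)
    (alpha : {unit F}) (omega : C) (x : F) : C :=
  if [pick h : 'I_3 | x \in cubic_coset alpha h] is Some h then omega ^+ h else 0.

Definition jacobi_sum (F : finFieldType) (C : numClosedFieldType)
    (chi psi : F -> C) : C :=
  \sum_(c : F * F | c.1 + c.2 == 1) chi c.1 * psi c.2.

(* Ordered pairs (z, w): j is the class of the first summand z, and i that of
   the second summand w. *)
Definition cubic_reps (F : finFieldType) (alpha : {unit F}) (beta : F)
    (i j : 'I_3) : nat :=
  #|[set zw : F * F | [&& zw.1 \in cubic_coset alpha j,
                          zw.2 \in cubic_coset alpha i & zw.1 + zw.2 == beta]]|.

Lemma cubic_char0 (F : finFieldType) (C : numClosedFieldType)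
    (alpha : {unit F}) (omega : C) : cubic_char alpha omega 0 = 0.
Proof.
rewrite /cubic_char; case: pickP => // h /imsetP[t]; rewrite inE => /andP[t0 _].
move/esym/eqP; rewrite mulf_eq0 (negPf t0) orbF expf_eq0 => /andP[_].
by move/eqP=> a0; have := valP alpha; rewrite -[val alpha]/(FinRing.uval alpha) a0 unitr0.
Qed.

Lemma cubic_charE (F : finFieldType) (C : numClosedFieldType)
    (alpha : {unit F}) (omega : C) (h : 'I_3) (theta : F) :
  generator [set: {unit F}] alpha -> (3 %| #|F| - 1)%N -> theta \in nonzero_cubes F ->
  cubic_char alpha omega (FinRing.uval alpha ^+ h * theta) = omega ^+ h.
Proof.
move=> gen_a dv3 At.
have a0 : FinRing.uval alpha != 0 by rewrite -unitfE; apply: (valP alpha).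
have oa : #[alpha]%g = (#|F| - 1)%N.
  by rewrite subn1 -card_finField_unit (eqP gen_a).
have log_cube x : x \in nonzero_cubes F ->
    exists k, x = FinRing.uval alpha ^+ (3 * k).
  rewrite inE => /andP[x0 /existsP[y /eqP xE]].
  have y0 : y != 0 by apply: contraNneq x0 => y0; rewrite xE y0 expr0n.
  have yu : y \is a GRing.unit by rewrite unitfE.
  have: FinRing.unit F yu \in <[alpha]>%g by rewrite -(eqP gen_a) inE.
  case/cycleP=> k /(congr1 val) /=; rewrite FinRing.val_unitX => yE.
  by exists k; rewrite xE yE mulnC exprM.
rewrite /cubic_char; case: pickP => [h'|/(_ h)]; last by rewrite imset_f.
case/imsetP=> t At'; have [k ->] := log_cube _ At; have [k' ->] := log_cube _ At'.
rewrite -!exprD -!FinRing.val_unitX => /val_inj/eqP; rewrite eq_expg_mod_order oa.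
move=> /eqP eqm; congr (_ ^+ _).
have: h + 3 * k = h' + 3 * k' %[mod 3].
  by rewrite -(modn_dvdm (h + 3 * k) dv3) eqm modn_dvdm.
by rewrite ![(_ + 3 * _)%N]addnC !(mulnC 3) !modnMDl !modn_small.
Qed.

(* Main.v *)
Require Import Defs.
From HB Require Import structures.
From mathcomp Require Import all_boot all_order all_algebra all_fingroup all_solvable all_field.
From mathcomp Require Import ring.

Set Implicit Arguments.
Unset Strict Implicit.
Unset Printing Implicit Defensive.

Import Order.TTheory GRing.Theory Num.Theory.

Local Open Scope ring_scope.

(* Orthogonality writes the indicator of the coset A_h as
     3 * [x in A_h] = [x != 0] + omega^(2h) chi(x) + omega^h chi(x)^2,
   with chi^2 the conjugate of chi.  Multiplying the indicators of A_j at z and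
   of A_i at beta - z and summing over z leaves nine character sums: the trivial
   one is q - 2, those with one trivial factor are - chi(beta) or its conjugate,
   chi * chi gives conj(chi(beta)) * J, and chi * chi^2, where
   chi(z) chi(beta - z)^2 = chi(beta / z - 1)^2, gives - chi(-1)^2 = -1. *)

(** * Changes of variable in finite sums *)

Lemma sum_pairs_addr (V : nmodType) (F : finZmodType) (f : F -> F -> V) (b : F) :
  \sum_(c : F * F | c.1 + c.2 == b) f c.1 c.2 = \sum_z f z (b - z).
Proof.
rewrite (reindex_onto (fun z => (z, b - z)) fst) /=.
  by apply: eq_bigl => z; rewrite addrC subrK !eqxx.
by case=> z w /= /eqP <-; rewrite addrAC subrr add0r.
Qed.

Lemma sum_affine (V : nmodType) (F : finFieldType) (f : F -> V) (a b : F) :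
  a != 0 -> \sum_x f (a * x + b) = \sum_x f x.
Proof.
move=> a0; rewrite [RHS](reindex_inj (h := fun x => a * x + b)) //.
by move=> x y /addIr/(mulfI a0).
Qed.

(** * The cubic character and the cosets it detects *)

Section CubicCharacter.

Variables (F : finFieldType) (C : numClosedFieldType).
Variables (alpha : {unit F}) (omega : C).
Hypotheses (gen_alpha : generator [set: {unit F}] alpha).
Hypotheses (dv3 : (3 %| #|F| - 1)%N) (prim_omega : 3.-primitive_root omega).

Local Notation a := (FinRing.uval alpha).
Local Notation chi := (cubic_char alpha omega).

Let a_neq0 : a != 0.
Proof. by rewrite -unitfE; apply: (valP alpha). Qed.

Let omega3 : omega ^+ 3 = 1.
Proof. exact: prim_expr_order. Qed.

Let omega_neq0 : omega != 0.
Proof. by rewrite (prim_root_eq0 prim_omega). Qed.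

Lemma primitive_elementP (x : F) : x != 0 -> exists n, x = a ^+ n.
Proof.
rewrite -unitfE => xu.
have: FinRing.unit F xu \in <[alpha]>%g by rewrite -(eqP gen_alpha) inE.
by case/cycleP=> n /(congr1 val) /=; rewrite FinRing.val_unitX; exists n.
Qed.

Let coset_exp n :
  a ^+ n = a ^+ (Ordinal (ltn_pmod n (isT : (0 < 3)%N))) * (a ^+ (n %/ 3)) ^+ 3.
Proof. by rewrite -exprM -exprD addnC -divn_eq. Qed.

Let cubes_exp n : (a ^+ n) ^+ 3 \in nonzero_cubes F.
Proof. by rewrite inE !expf_neq0 //=; apply/existsP; exists (a ^+ n). Qed.

Lemma cubic_char_exp n : chi (a ^+ n) = omega ^+ n.
Proof.
rewrite coset_exp cubic_charE //= [RHS](_ : _ = omega ^+ (n %% 3)) //.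
by rewrite -(prim_expr_mod prim_omega).
Qed.

Lemma cubic_charM x y : chi (x * y) = chi x * chi y.
Proof.
have [->|/primitive_elementP[n ->]] := eqVneq x 0.
  by rewrite mul0r cubic_char0 mul0r.
have [->|/primitive_elementP[k ->]] := eqVneq y 0.
  by rewrite mulr0 cubic_char0 mulr0.
by rewrite -exprD !cubic_char_exp exprD.
Qed.

Lemma cubic_char_cube x : x != 0 -> chi x ^+ 3 = 1.
Proof.
case/primitive_elementP=> n ->.
by rewrite cubic_char_exp exprAC omega3 expr1n.
Qed.

Lemma cubic_char1 : chi 1 = 1.
Proof. by rewrite -(expr0 a) cubic_char_exp. Qed.

(** The value is a cube root of unity because [-1] is nonzero, and its square is 1 because [-1]
    squares to 1; only 1 satisfies both. *)
Lemma cubic_charN1 : chi (-1) = 1.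
Proof.
have <- : chi (-1) ^+ 3 = 1 by rewrite cubic_char_cube // oppr_eq0 oner_eq0.
by rewrite exprSr expr2 -cubic_charM mulrNN mulr1 cubic_char1 mul1r.
Qed.

(** Such a [z] has modulus 1, so both [z^*] and [z ^+ 2] are inverse to it. *)
Lemma conj_cube_root (z : C) : z ^+ 3 = 1 -> z^* = z ^+ 2.
Proof.
move=> z3; have z0 : z != 0.
  by apply/eqP => z0; move/eqP: z3; rewrite z0 expr0n eq_sym oner_eq0.
have nz : `|z| = 1.
  by apply/eqP; rewrite -(@pexpr_eq1 _ _ 3) ?normr_ge0 // -normrX z3 normr1.
by apply: (mulfI z0); rewrite -normCK nz expr1n -exprS z3.
Qed.

Lemma conj_cubic_char x : (chi x)^* = chi x ^+ 2.
Proof.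
have [->|x0] := eqVneq x 0; first by rewrite cubic_char0 conjC0 expr0n.
exact/conj_cube_root/cubic_char_cube.
Qed.

Lemma mem_cubic_coset (h : 'I_3) x :
  (x \in cubic_coset alpha h) = (chi x == omega ^+ h).
Proof.
apply/idP/eqP => [/imsetP[t tA ->]|]; first exact: cubic_charE.
have [->|/primitive_elementP[n ->]] := eqVneq x 0.
  by rewrite cubic_char0 => /esym/eqP; rewrite expf_eq0 (negPf omega_neq0) andbF.
rewrite cubic_char_exp => /eqP; rewrite (eq_prim_root_expr prim_omega) => /eqP nh.
rewrite coset_exp; suff -> : Ordinal (ltn_pmod n (isT : (0 < 3)%N)) = h.
  exact: imset_f.
by apply: val_inj; rewrite /= nh modn_small.
Qed.

(** * Orthogonality on the cube roots of unity *)

Lemma sum_powers_cube_root (z : C) : z ^+ 3 = 1 -> 1 + z + z ^+ 2 = 3 * (z == 1)%:R.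
Proof.
move=> z3; have [->|z1] := eqVneq z 1; first by rewrite expr1n /=; ring.
have z1' : z - 1 != 0 by rewrite subr_eq0.
apply: (mulfI z1'); rewrite /= !mulr0.
by have -> : (z - 1) * (1 + z + z ^+ 2) = z ^+ 3 - 1 by [ring]; rewrite z3 subrr.
Qed.

Lemma cubic_coset_indicator (h : 'I_3) x :
  3 * (x \in cubic_coset alpha h)%:R =
    (x != 0)%:R + (omega ^+ h) ^+ 2 * chi x + omega ^+ h * chi x ^+ 2.
Proof.
have h3 : (omega ^+ h) ^+ 3 = 1 by rewrite exprAC omega3 expr1n.
have h0 : omega ^+ h != 0 by rewrite expf_neq0.
rewrite mem_cubic_coset; have [->|x0] := eqVneq x 0.
  by rewrite cubic_char0 eq_sym (negPf h0) expr0n /= !mulr0 !addr0.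
set u := omega ^+ h in h3 h0 *.
(* [u ^+ 2] is the inverse of [u], so membership says that the cube root of unity [chi x / u] is 1,
   and orthogonality applies to it. *)
have -> : (chi x == u) = (u ^+ 2 * chi x == 1).
  by rewrite -(inj_eq (mulfI (expf_neq0 2 h0))) -[u ^+ 2 * u]exprSr h3.
rewrite -sum_powers_cube_root; last by rewrite exprMn exprAC h3 expr1n mul1r cubic_char_cube.
have u4 : (u ^+ 2) ^+ 2 = u ^+ 3 * u by ring.
by rewrite exprMn u4 h3 mul1r.
Qed.

(** * Complete character sums *)

Lemma sum_cubic_char : \sum_x chi x = 0.
Proof.
have w1 : omega - 1 != 0.
  by rewrite subr_eq0 -[omega]expr1 -[1](expr0 omega) (eq_prim_root_expr prim_omega).
apply: (mulfI w1); rewrite mulr0 mulrBl mul1r; apply/eqP; rewrite subr_eq0.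
(* Multiplication by [alpha] permutes the field and multiplies the sum by [omega], which differs
   from 1. *)
rewrite mulr_sumr -[X in _ == X](sum_affine _ 0 a_neq0); apply/eqP/eq_bigr => x _.
by rewrite addr0 cubic_charM (cubic_char_exp 1).
Qed.

Lemma sum_cubic_char2 : \sum_x chi x ^+ 2 = 0.
Proof.
transitivity ((\sum_x chi x)^*); last by rewrite sum_cubic_char conjC0.
rewrite rmorph_sum /=.
by apply: eq_bigr => x _; rewrite -conj_cubic_char.
Qed.

Lemma sum_neq0_mul (f : F -> C) : \sum_z (z != 0)%:R * f z = \sum_z f z - f 0.
Proof.
rewrite (bigD1 0) //= eqxx mul0r add0r [in RHS](bigD1 0) //= [f 0 + _]addrC addrK.
by apply: eq_bigr => z ->; rewrite mul1r.
Qed.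

Lemma sum_comp_subl (V : nmodType) (f : F -> V) b : \sum_z f (b - z) = \sum_z f z.
Proof.
rewrite -(sum_affine f b (a := -1)) ?oppr_eq0 ?oner_eq0 //.
by apply: eq_bigr => z _; rewrite mulN1r addrC.
Qed.

Lemma sum_cubic_char_cubic_char b : b != 0 ->
  \sum_z chi z * chi (b - z) = chi b ^+ 2 * jacobi_sum chi chi.
Proof.
move=> b0; rewrite /jacobi_sum (sum_pairs_addr (fun x y => chi x * chi y)).
(* Scaling [z] by [b] takes [chi b] out of both factors and leaves the pairs with sum 1. *)
rewrite -[LHS](sum_affine _ 0 b0) mulr_sumr; apply: eq_bigr => z _.
by rewrite addr0 -[b in chi (b - _)]mulr1 -mulrBr !cubic_charM; ring.
Qed.

Lemma sum_cubic_char_conj b : b != 0 -> \sum_z chi z * chi (b - z) ^+ 2 = -1.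
Proof.
move=> b0; transitivity (\sum_z (z != 0)%:R * chi (b * z - 1) ^+ 2).
  (* Inversion, with [0^-1 = 0], permutes the whole field and turns [b * z - 1] into [b / z - 1]; at
     [z = 0] both sides vanish. *)
  rewrite [RHS](reindex_inj (@invr_inj F)); apply: eq_bigr => z _; rewrite invr_eq0.
  have [->|z0] := eqVneq z 0; first by rewrite cubic_char0 !mul0r.
  have {1}-> : b - z = z * (b / z - 1) by rewrite mulrBr mulrCA divff // !mulr1.
  by rewrite mul1r cubic_charM exprMn mulrA -exprS cubic_char_cube ?mul1r.
(* The complete sum is 0, so only the omitted term at [z = 0], equal to [chi (-1) ^+ 2],
   survives. *)
rewrite sum_neq0_mul mulr0 sub0r cubic_charN1 expr1n.
by rewrite (sum_affine (fun x => chi x ^+ 2)) // sum_cubic_char2 sub0r.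
Qed.

(** * Evaluation of the nine sums *)

Lemma card_cubic_reps (b : F) (i j : 'I_3) : b != 0 ->
  let J := jacobi_sum chi chi in
  let K := chi b * (omega ^+ (2 * i) + omega ^+ (2 * j)) + omega ^+ (2 * i + j)
           - omega ^+ (2 * i + 2 * j) * (chi b)^* * J in
  9 * (cubic_reps alpha b i j)%:R = #|F|%:R - 2 - K - K^*.
Proof.
move=> b0 J K.
have -> : (cubic_reps alpha b i j)%:R =
    \sum_z (z \in cubic_coset alpha j)%:R * (b - z \in cubic_coset alpha i)%:R :> C.
  rewrite -(sum_pairs_addr
    (fun z w => (z \in cubic_coset alpha j)%:R * (w \in cubic_coset alpha i)%:R)).
  rewrite /cubic_reps -sum1_card natr_sum big_mkcond [RHS]big_mkcond /=.
  apply: eq_bigr => -[z w] _; rewrite inE /=.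
  by do 3 case: (_ \in _) || case: (_ == _); rewrite ?mulr1 ?mulr0 ?mul0r.
have w3 (h : 'I_3) : (omega ^+ h) ^+ 3 = 1 by rewrite exprAC omega3 expr1n.
have w2 (h : 'I_3) : omega ^+ (2 * h) = (omega ^+ h) ^+ 2 by rewrite mulnC exprM.
have := conj_cube_root (w3 i); have := conj_cube_root (w3 j).
have := cubic_coset_indicator i; have := cubic_coset_indicator j.
move: (w3 i) (w3 j); rewrite /K ![omega ^+ (2 * i + _)]exprD !w2.
move: (omega ^+ i) (omega ^+ j) => u v u3 v3 Ej Ei cv cu.
(* The two excluded points, 0 and [b], are distinct because [b] is nonzero. *)
have S0 : \sum_z (z != 0)%:R * (b - z != 0)%:R = #|F|%:R - 2 :> C.
  rewrite sum_neq0_mul subr0 b0 (sum_comp_subl (fun z => (z != 0)%:R)).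
  have := sum_neq0_mul (fun _ => 1); rewrite sumr_const.
  under eq_bigr do rewrite mulr1.
  by move=> ->; rewrite mulr1n; ring.
have S1 : \sum_z (z != 0)%:R * chi (b - z) = - chi b.
  by rewrite sum_neq0_mul subr0 (sum_comp_subl chi) sum_cubic_char sub0r.
have S2 : \sum_z (z != 0)%:R * chi (b - z) ^+ 2 = - chi b ^+ 2.
  by rewrite sum_neq0_mul subr0 (sum_comp_subl (fun z => chi z ^+ 2)) sum_cubic_char2 sub0r.
(* The substitution of [b - z] for [z] swaps the factors, so each mixed sum also gives its
   transpose. *)
have flip (f g : F -> C) : \sum_z f z * g (b - z) = \sum_z g z * f (b - z).
  rewrite -(sum_comp_subl _ b); apply: eq_bigr => z _.
  by rewrite mulrC opprB addrC subrK.
have S11 := sum_cubic_char_cubic_char b0.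
have S12 := sum_cubic_char_conj b0.
(* This is the conjugate of the sum in [S11]. *)
have S22 : \sum_z chi z ^+ 2 * chi (b - z) ^+ 2 = chi b * J^*.
  have -> : chi b = (chi b ^+ 2)^* by rewrite -conj_cubic_char conjCK.
  rewrite -rmorphM -S11 rmorph_sum; apply: eq_bigr => z _.
  by rewrite rmorphM /= !conj_cubic_char.
have S10 := flip chi (fun z => (z != 0)%:R); rewrite /= S1 in S10.
have S20 := flip (fun z => chi z ^+ 2) (fun z => (z != 0)%:R); rewrite /= S2 in S20.
have S21 := flip (fun z => chi z ^+ 2) chi; rewrite /= S12 in S21.
transitivity (\sum_z (z != 0)%:R * (b - z != 0)%:R
    + u ^+ 2 * \sum_z (z != 0)%:R * chi (b - z)
    + u * \sum_z (z != 0)%:R * chi (b - z) ^+ 2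
    + v ^+ 2 * \sum_z chi z * (b - z != 0)%:R
    + v ^+ 2 * u ^+ 2 * \sum_z chi z * chi (b - z)
    + v ^+ 2 * u * \sum_z chi z * chi (b - z) ^+ 2
    + v * \sum_z chi z ^+ 2 * (b - z != 0)%:R
    + v * u ^+ 2 * \sum_z chi z ^+ 2 * chi (b - z)
    + v * u * \sum_z chi z ^+ 2 * chi (b - z) ^+ 2 : C).
  rewrite !mulr_sumr -!big_split; apply: eq_bigr => z _ /=.
  have -> (x y : C) : 9 * (x * y) = (3 * x) * (3 * y) by ring.
  by rewrite Ej Ei; ring.
rewrite S0 S1 S2 S10 S20 S11 S12 S21 S22.
rewrite !(rmorphD, rmorphB, rmorphN, rmorphM, rmorphXn) /= !cu !cv !conjCK.
rewrite !conj_cubic_char -/J.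
(* Conjugation turns [u ^+ 2] into [(u ^+ 2) ^+ 2]; this must be reduced by [u ^+ 3 = 1] first, a
   relation [ring] cannot see. *)
have u4 : (u ^+ 2) ^+ 2 = u by rewrite -[RHS]mul1r -u3; ring.
have v4 : (v ^+ 2) ^+ 2 = v by rewrite -[RHS]mul1r -v3; ring.
rewrite -!expr2 !u4 !v4; ring.
Qed.

End CubicCharacter.

Theorem theorem2 (p m : nat) (F : finFieldType) (C : numClosedFieldType)
    (alpha : {unit F}) (omega : C) (beta : F) (i j : 'I_3)
    (hp : prime p) (hm : (1 <= m)%N) (hF : #|F| = (p ^ m)%N)
    (h3 : (3 %| p ^ m - 1)%N)
    (halpha : generator [set: {unit F}] alpha)
    (homega : 3.-primitive_root omega)
    (hbeta : beta != 0) :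
  let chi3 := cubic_char alpha omega in
  let J := jacobi_sum chi3 chi3 in
  let K := chi3 beta * (omega ^+ (2 * i) + omega ^+ (2 * j))
           + omega ^+ (2 * i + j)
           - omega ^+ (2 * i + 2 * j) * (chi3 beta)^* * J in
  (cubic_reps alpha beta i j)%:R = 9^-1 * ((p ^ m)%:R - 2 - K - K^*)
  /\ (forall beta' : F, beta' != 0 -> chi3 beta' = chi3 beta ->
        cubic_reps alpha beta' i j = cubic_reps alpha beta i j).
Proof.
move=> chi3 J K; rewrite -hF in h3.
have nz9 : 9 != 0 :> C by rewrite pnatr_eq0.
have card := card_cubic_reps halpha h3 homega i j.
split; first by rewrite -hF -(card beta hbeta) mulKf.
(* Natural numbers embed in [C], so the counts can be compared there, where the formula involves the
   summed element only through its character value. *)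
move=> beta' beta'0 eq_chi; apply/eqP; rewrite -(eqr_nat C); apply/eqP.
by apply: (mulfI nz9); rewrite !card //= -/chi3 eq_chi.
Qed.
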